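(* Let $\mathbf X\in\mathbb R^{n\times p}$ be deterministic with columns satisfying $\|\boldsymbol x^j\|_2^2\le n$, $\boldsymbol\beta^*\in\mathbb R^p$, $\sigma^*>0$, and $\boldsymbol y=\mathbf X\boldsymbol\beta^*+\boldsymbol\xi$ with $\boldsymbol\xi\sim\mathcal N_n(0,\sigma^{*2}\mathbf I_n)$. Let $T\subset[p]$ be a set of indices and $\delta>0$, $\gamma>1$ be constants. If the tuning parameter $\lambda>0$ satisfies $\lambda\ge\gamma\sigma^*\rho_T\sqrt{2\log(p/\delta)/n}$, then the Lasso $\widehat{\boldsymbol\beta}_\lambda$ fulfills $$\ell_n(\widehat{\boldsymbol\beta}_\lambda,\boldsymbol\beta^* )\le\frac{4\rho_T^2\gamma^2}{(\gamma-1)^2}\|\boldsymbol\beta^*\|_1^2+\frac{4\sigma^{*2}(|T|+2\log(1/\delta))}{n}+\frac{2|T|\lambda^2}{\nu_T^2}$$ with probability at least $1-2\delta$.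
   Context: $[p]=\{1,\dots,p\}$. $\widehat{\boldsymbol\beta}_\lambda$ is any element of $\arg\min_{\boldsymbol\beta\in\mathbb R^p}\{\frac1{2n}\|\boldsymbol y-\mathbf X\boldsymbol\beta\|_2^2+\lambda\|\boldsymbol\beta\|_1\}$. The prediction loss is $\ell_n(\boldsymbol\beta,\boldsymbol\beta')=\frac1n\|\mathbf X(\boldsymbol\beta-\boldsymbol\beta')\|_2^2$. $\mathbf X_T$ is the submatrix of columns $\boldsymbol x^j$ of $\mathbf X$ with $j\in T$; $\Pi_T$ is the orthogonal projector of $\mathbb R^n$ onto the span of $\{\boldsymbol x^j:j\in T\}$; $\rho_T=n^{-1/2}\max_{j\in[p]}\|(\mathbf I_n-\Pi_T)\boldsymbol x^j\|_2$; $\nu_T=\inf_{\boldsymbol u\in\mathbb R^{|T|},\,\boldsymbol u\ne0}\frac{\sqrt{|T|}\,\|\mathbf X_T\boldsymbol u\|_2}{\sqrt n\,\|\boldsymbol u\|_1}$. For $T\ne\varnothing$ with $\nu_T=0$ the last term of the bound is $+\infty$; for $T=\varnothing$ it is $0$. *)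

(* Defs.v *)
From HB Require Import structures.
From mathcomp Require Import all_boot all_order all_algebra.
From mathcomp Require Import all_classical all_reals all_analysis.
Set Implicit Arguments.
Unset Strict Implicit.
Unset Printing Implicit Defensive.
Import Order.TTheory GRing.Theory Num.Theory.
Import numFieldNormedType.Exports.
Local Open Scope classical_set_scope.
Local Open Scope ring_scope.

(* The library's norm on matrices is the sup norm. *)
Definition norm1 (R : realType) (m : nat) (v : 'cV[R]_m) : R :=
  \sum_(i < m) `|v i 0|.

Definition norm2 (R : realType) (m : nat) (v : 'cV[R]_m) : R :=
  Num.sqrt (\sum_(i < m) v i 0 ^+ 2).

Definition lasso_objective (R : realType) (n p : nat) (X : 'M[R]_(n, p))
    (y : 'cV[R]_n) (lambda : R) (b : 'cV[R]_p) : R :=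
  (2 * n%:R)^-1 * norm2 (y - X *m b) ^+ 2 + lambda * norm1 b.

Definition is_lasso (R : realType) (n p : nat) (X : 'M[R]_(n, p))
    (y : 'cV[R]_n) (lambda : R) (b : 'cV[R]_p) : Prop :=
  forall b' : 'cV[R]_p,
    lasso_objective X y lambda b <= lasso_objective X y lambda b'.

Definition pred_loss (R : realType) (n p : nat) (X : 'M[R]_(n, p))
    (b b' : 'cV[R]_p) : R :=
  n%:R^-1 * norm2 (X *m (b - b')) ^+ 2.

Definition subcols (R : realType) (n p : nat) (X : 'M[R]_(n, p))
    (T : {set 'I_p}) : 'M[R]_(n, #|T|) :=
  colsub (fun k : 'I_#|T| => enum_val k) X.

(* [proj_mx U V] acts on row vectors, projecting onto the row space of U along
   that of V.  With S := subcols X T, the row space of S^T is the (transposed)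
   span of the columns of S, and [kermx S] is its orthogonal complement; the
   outer transpose gives the operator acting on column vectors. *)
Definition orth_proj (R : realType) (n p : nat) (X : 'M[R]_(n, p))
    (T : {set 'I_p}) : 'M[R]_n :=
  (proj_mx <<(subcols X T)^T>>%MS (kermx (subcols X T)))^T.

Lemma orth_projP (R : realType) (n p : nat) (X : 'M[R]_(n, p))
    (T : {set 'I_p}) (v : 'cV[R]_n) :
  (exists u : 'cV[R]_#|T|, orth_proj X T *m v = subcols X T *m u) /\
  (subcols X T)^T *m (v - orth_proj X T *m v) = 0.
Proof.
rewrite /orth_proj; set S := subcols X T; set Q := proj_mx _ _.
have cap0 : (<<S^T>> :&: kermx S)%MS = 0.
  apply/eqP/rowV0P => w; rewrite sub_capmx genmxE => /andP[/submxP[u wE]].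
  move=> /sub_kermxP wS0.
  have : (w *m w^T) 0 0 = 0.
    by rewrite {2}wE trmx_mul trmxK mulmxA wS0 mul0mx mxE.
  rewrite mxE => /eqP; rewrite psumr_eq0 => [/allP w0|i _]; last first.
    by rewrite mxE -expr2 sqr_ge0.
  apply/rowP => j; move: (w0 j (mem_index_enum j)); rewrite !mxE mulf_eq0 orbb.
  by move/eqP.
have sumT : (1%:M <= <<S^T>> + kermx S)%MS.
  rewrite (@sub1mx _ _ _ _) /row_full eqn_leq rank_leq_col /=.
  rewrite (mxdirectP _) /=; last by apply/mxdirect_addsP.
  by rewrite genmxE mxrank_tr mxrank_ker subnKC // rank_leq_row.
have vT (M : 'M[R]_n) : M^T *m v = (v^T *m M)^T.
  by rewrite trmx_mul trmxK.
split.
  have /submxP[u uE] : (v^T *m Q <= S^T)%MS.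
    by rewrite -(genmxE S^T) proj_mx_sub.
  by exists u^T; rewrite vT uE trmx_mul trmxK.
have /sub_kermxP vQ0 : (v^T - v^T *m Q <= kermx S)%MS.
  by apply: proj_mx_compl_sub; rewrite (submx_trans _ sumT) // submx1.
by rewrite vT -[v in v - _]trmxK -linearB /= -trmx_mul vQ0 trmx0.
Qed.

Definition rho (R : realType) (n p : nat) (X : 'M[R]_(n, p))
    (T : {set 'I_p}) : R :=
  (Num.sqrt n%:R)^-1 *
  \big[Num.max/0]_(j < p) norm2 ((1%:M - orth_proj X T) *m col j X).

(* Only meaningful for nonempty T: otherwise the infimum is over the empty
   set, which [inf] sends to 0. *)
Definition nu (R : realType) (n p : nat) (X : 'M[R]_(n, p))
    (T : {set 'I_p}) : R :=
  inf [set Num.sqrt #|T|%:R * norm2 (subcols X T *m u)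
             / (Num.sqrt n%:R * norm1 u)
      | u in [set u : 'cV[R]_#|T| | u != 0]].

Definition nu_term (R : realType) (n p : nat) (X : 'M[R]_(n, p))
    (T : {set 'I_p}) (lambda : R) : \bar R :=
  if #|T| == 0%N then 0%E
  else if nu X T == 0 then +oo%E
  else (2 * #|T|%:R * lambda ^+ 2 / nu X T ^+ 2)%:E.

Definition mutually_independent (d : measure_display) (Omega : measurableType d)
    (R : realType) (P : probability Omega R) (I : finType)
    (Z : I -> {RV P >-> R}) : Prop :=
  forall (J : {set I}) (A : I -> set R), (forall i, measurable (A i)) ->
    P (\bigcap_(i in [set i | i \in J]) Z i @^-1` A i) =
    (\prod_(i in J) P (Z i @^-1` A i))%E.

(* N_n(0, s^2 I_n): independent coordinates with law N(0, s^2); the second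
   parameter of [normal_prob] is the standard deviation. *)
Definition isotropic_gaussian (d : measure_display) (Omega : measurableType d)
    (R : realType) (P : probability Omega R) (n : nat) (s : R)
    (xi : 'I_n -> {RV P >-> R}) : Prop :=
  mutually_independent xi /\
  forall (i : 'I_n) (A : set R), measurable A ->
    distribution P (xi i) A = normal_prob 0 s A.

(* Inner-probability form: the event S itself is not required to be
   measurable; when it is, this says q <= P S. *)
Definition with_prob_at_least (d : measure_display) (Omega : measurableType d)
    (R : realType) (P : probability Omega R) (q : R) (S : set Omega) : Prop :=
  exists E : set Omega, [/\ measurable E, E `<=` S & (q%:E <= P E)%E].

(* Main.v *)
Require Import Defs.
From HB Require Import structures.
From mathcomp Require Import all_boot all_order all_algebra.
From mathcomp Require Import all_classical all_reals all_analysis.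
From mathcomp Require Import measurable_realfun ring lra.
Set Implicit Arguments.
Unset Strict Implicit.
Unset Printing Implicit Defensive.
Import Order.TTheory GRing.Theory Num.Theory.
Import numFieldNormedType.Exports.
Local Open Scope classical_set_scope.
Local Open Scope ring_scope.

(** Write w for the prediction error X (bh - beta_star), where bh is a Lasso
    solution, and split it as w = a + q with a its projection onto the span of
    the columns in T.  The two parts are controlled by two different
    comparisons, both read off the variational inequality of the convex
    program ([lasso_variational]):

      <X (b - bh), y - X bh> / n <= lambda (|b|_1 - |bh|_1)   for every b.

    - Let h be supported on T with X h = a.  The comparator bh - h gives
      |a|^2 <= <a, xi> + n lambda |h|_1, and the compatibility constant nu
      bounds |h|_1 by a multiple of |a|; hence |a| is at most the size of the
      noise inside the span plus the term in lambda.  This is the fast rate.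
    - The comparator beta_star gives an upper bound on |a|^2 + |q|^2 which is
      increasing in |beta_star|_1 and, as gamma > 1, decreasing in |bh|_1.
      Either |bh|_1 is so large that the l1 terms are nonpositive and only noise
      remains, or |bh|_1 <= (gamma + 1) / (gamma - 1) |beta_star|_1, and then
      |q| <= sqrt n rho |bh - beta_star|_1 yields the slow rate, in which
      lambda does not occur ([two_regime_bound], [oracle_inequality]).

    Two facts about the noise are used.  Each linear form <v, xi> exceeds
    sigma |v| t with probability at most exp (- t^2 / 2), both signs included:
    with constant 1 in front, a union bound over p columns costs exactly delta,
    while a Chernoff bound on each side would cost 2 delta.  This sharp tail
    needs the exact law of the form, obtained by adding the independent
    coordinates one at a time ([linear_form_law]).  The squared norm of the noise
    inside the span is a chi-square variable with at most |T| degrees of freedom;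
    the exponential moment of order 1/4 bounds its tail by delta at
    2 |T| + 4 ln (1 / delta) ([chi2_tail]).  That moment is computed without
    rotating the noise: each square is linearized by an auxiliary Gaussian
    variable, which leaves exponentials of linear forms
    ([integral_expR_chi2]). *)

(** * Euclidean geometry of column vectors *)

Definition dot (R : realType) (m : nat) (u v : 'cV[R]_m) : R :=
  \sum_(i < m) u i 0 * v i 0.

Section Vectors.
Context {R : realType}.

Lemma dotE m (u v : 'cV[R]_m) : dot u v = (u^T *m v) 0 0.
Proof. by rewrite mxE; apply: eq_bigr => i _; rewrite mxE. Qed.

Lemma dotC m (u v : 'cV[R]_m) : dot u v = dot v u.
Proof. by apply: eq_bigr => i _; rewrite mulrC. Qed.

Lemma dotDr m (u v w : 'cV[R]_m) : dot u (v + w) = dot u v + dot u w.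
Proof. by rewrite !dotE mulmxDr mxE. Qed.

Lemma dotNr m (u v : 'cV[R]_m) : dot u (- v) = - dot u v.
Proof. by rewrite !dotE mulmxN mxE. Qed.

Lemma dotBr m (u v w : 'cV[R]_m) : dot u (v - w) = dot u v - dot u w.
Proof. by rewrite dotDr dotNr. Qed.

Lemma dotZr m k (u v : 'cV[R]_m) : dot u (k *: v) = k * dot u v.
Proof. by rewrite !dotE -scalemxAr mxE. Qed.

Lemma dot0r m (u : 'cV[R]_m) : dot u 0 = 0.
Proof. by rewrite dotE mulmx0 mxE. Qed.

Lemma dotDl m (u v w : 'cV[R]_m) : dot (v + w) u = dot v u + dot w u.
Proof. by rewrite dotC dotDr !(dotC u). Qed.

Lemma dotNl m (u v : 'cV[R]_m) : dot (- v) u = - dot v u.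
Proof. by rewrite dotC dotNr dotC. Qed.

Lemma dotZl m k (u v : 'cV[R]_m) : dot (k *: v) u = k * dot v u.
Proof. by rewrite dotC dotZr dotC. Qed.

Lemma dot_mulmx m k (A : 'M[R]_(m, k)) u v : dot (A *m u) v = dot u (A^T *m v).
Proof. by rewrite !dotE trmx_mul mulmxA. Qed.

Lemma dotvv_eq0 m (u : 'cV[R]_m) : (dot u u == 0) = (u == 0).
Proof.
apply/idP/eqP => [|->]; last by rewrite dot0r.
rewrite psumr_eq0 => [/allP u0|i _]; last by rewrite -expr2 sqr_ge0.
apply/colP => i; have := u0 i (mem_index_enum i).
by rewrite mulf_eq0 orbb mxE => /eqP.
Qed.

Lemma norm2_ge0 m (u : 'cV[R]_m) : 0 <= norm2 u.
Proof. exact: sqrtr_ge0. Qed.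

Lemma sqr_norm2 m (u : 'cV[R]_m) : norm2 u ^+ 2 = dot u u.
Proof.
rewrite /norm2 sqr_sqrtr; last by apply: sumr_ge0 => i _; exact: sqr_ge0.
by apply: eq_bigr => i _; rewrite expr2.
Qed.

Lemma norm2_eq0 m (u : 'cV[R]_m) : (norm2 u == 0) = (u == 0).
Proof. by rewrite -sqrf_eq0 sqr_norm2 dotvv_eq0. Qed.

Lemma sqr_norm2D m (u v : 'cV[R]_m) :
  norm2 (u + v) ^+ 2 = norm2 u ^+ 2 + dot u v *+ 2 + norm2 v ^+ 2.
Proof. by rewrite !sqr_norm2 dotDl !dotDr (dotC v u) mulr2n !addrA. Qed.

Lemma norm2Z m k (u : 'cV[R]_m) : norm2 (k *: u) = `|k| * norm2 u.
Proof.
apply/eqP; rewrite -(@eqrXn2 _ 2%N) ?mulr_ge0 ?norm2_ge0 //.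
by rewrite exprMn !sqr_norm2 dotZl dotZr mulrA -expr2 real_normK ?num_real.
Qed.

Lemma norm2_gt0 m (u : 'cV[R]_m) : (0 < norm2 u) = (u != 0).
Proof. by rewrite lt_neqAle eq_sym norm2_eq0 norm2_ge0 andbT. Qed.

(** Expand the square of the norm of |v| u - |u| v. *)
Lemma cauchy_schwarz m (u v : 'cV[R]_m) : dot u v <= norm2 u * norm2 v.
Proof.
have [->|u0] := eqVneq u 0.
  by rewrite dotC dot0r mulr_ge0 ?norm2_ge0.
have [->|v0] := eqVneq v 0; first by rewrite dot0r mulr_ge0 ?norm2_ge0.
have := sqr_ge0 (norm2 (norm2 v *: u + (- norm2 u) *: v)).
rewrite sqr_norm2D dotZl dotZr !norm2Z normrN !ger0_norm ?norm2_ge0 //.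
rewrite -!norm2_gt0 in u0 v0.
move: (dot u v) (norm2 u) (norm2 v) u0 v0 => d a b a0 b0.
rewrite (_ : _ + _ + _ = 2 * (b * a) * (a * b - d)); last by ring.
by rewrite pmulr_rge0 ?subr_ge0 // !mulr_gt0.
Qed.

Lemma abs_cauchy_schwarz m (u v : 'cV[R]_m) : `|dot u v| <= norm2 u * norm2 v.
Proof.
rewrite ler_norml cauchy_schwarz andbT lerNl -dotNl.
rewrite (le_trans (cauchy_schwarz _ _)) // -scaleN1r norm2Z normrN1 mul1r.
exact: lexx.
Qed.

Lemma norm1_ge0 m (u : 'cV[R]_m) : 0 <= norm1 u.
Proof. by apply: sumr_ge0 => i _. Qed.

Lemma norm1D m (u v : 'cV[R]_m) : norm1 (u + v) <= norm1 u + norm1 v.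
Proof.
by rewrite -big_split; apply: ler_sum => i _; rewrite mxE ler_normD.
Qed.

Lemma norm1Z m k (u : 'cV[R]_m) : norm1 (k *: u) = `|k| * norm1 u.
Proof. by rewrite mulr_sumr; apply: eq_bigr => i _; rewrite mxE normrM. Qed.

Lemma norm1B m (u v : 'cV[R]_m) : norm1 (u - v) <= norm1 u + norm1 v.
Proof.
by rewrite (le_trans (norm1D _ _))// -scaleN1r norm1Z normrN1 mul1r.
Qed.

Lemma norm1_eq0 m (u : 'cV[R]_m) : (norm1 u == 0) = (u == 0).
Proof.
apply/idP/eqP => [|->]; last first.
  by rewrite /norm1 big1 // => i _; rewrite mxE normr0.
rewrite psumr_eq0 // => /allP u0; apply/colP => i.
by have := u0 i (mem_index_enum i); rewrite normr_eq0 mxE => /eqP.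
Qed.

Lemma dot_norm1 m (u v : 'cV[R]_m) M :
  (forall i, `|v i 0| <= M) -> `|dot u v| <= norm1 u * M.
Proof.
move=> vM; rewrite (le_trans (ler_norm_sum _ _ _))// mulr_suml.
by apply: ler_sum => i _; rewrite normrM ler_wpM2l.
Qed.

Lemma dot_mulmx_norm1 n p (A : 'M[R]_(n, p)) u v M :
  (forall j, `|dot (col j A) v| <= M) -> `|dot (A *m u) v| <= norm1 u * M.
Proof.
move=> AM; rewrite dot_mulmx; apply: dot_norm1 => j.
by rewrite (_ : _ j 0 = dot (col j A) v) // dotE tr_col -row_mul [RHS]mxE.
Qed.

(** Pair A u with itself: by duality between the l1 and sup norms, only the
    pairings of the columns of A with A u matter. *)
Lemma norm2_mulmx_norm1 n p (A : 'M[R]_(n, p)) u M :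
  (forall j, norm2 (col j A) <= M) -> norm2 (A *m u) <= norm1 u * M.
Proof.
move=> AM; have [->|Au0] := eqVneq (A *m u) 0; last first.
  have Aup : 0 < norm2 (A *m u) by rewrite norm2_gt0.
  rewrite -(ler_pM2r Aup) -expr2 sqr_norm2 -mulrA.
  apply: le_trans (ler_norm _) _; apply: dot_mulmx_norm1 => j.
  exact: le_trans (abs_cauchy_schwarz _ _) (ler_wpM2r (norm2_ge0 _) (AM j)).
rewrite (eqP (etrans (norm2_eq0 _) (eqxx _))).
case: p A u AM => [|p] A u AM; first by rewrite /norm1 big_ord0 mul0r.
by rewrite mulr_ge0 ?norm1_ge0 // (le_trans (norm2_ge0 _) (AM ord0)).
Qed.

Lemma sqr_norm2_trmul n r (E : 'M[R]_(n, r)) v :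
  norm2 (E^T *m v) ^+ 2 = \sum_k dot (col k E) v ^+ 2.
Proof.
rewrite sqr_norm2; apply: eq_bigr => k _.
rewrite -expr2; congr (_ ^+ 2).
by rewrite dotE tr_col -row_mul [RHS]mxE.
Qed.

(** The columns are treated from the last to the first: the residual of the new
    column is normalized when it is nonzero, and otherwise contributes no new
    direction. *)
Lemma gram_schmidt n m (S : 'M[R]_(n, m)) :
  exists r, exists E : 'M[R]_(n, r), exists C : 'M[R]_(r, m),
    [/\ (r <= m)%N, E^T *m E = 1%:M & S = E *m C].
Proof.
elim: m S => [|m IHm] S.
  exists 0%N, 0, 0; split => //; last by apply/matrixP => i [].
  by apply/matrixP => -[].
have [r [E [C [rm EE SE]]]] := IHm (rsubmx (S : 'M[R]_(n, 1 + m))).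
pose s := lsubmx (S : 'M[R]_(n, 1 + m)).
have SE' : S = row_mx s (E *m C) by rewrite -SE hsubmxK.
pose q := s - E *m (E^T *m s).
have Eq0 : E^T *m q = 0 by rewrite mulmxBr !mulmxA EE mul1mx subrr.
have sE : s = q + E *m (E^T *m s) by rewrite subrK.
have [q0|q0] := eqVneq q 0.
  exists r, E, (row_mx (E^T *m s) C); split; first exact: ltnW.
    by [].
  by rewrite SE' [in LHS]sE q0 add0r -mul_mx_row.
pose e := (norm2 q)^-1 *: q.
have qn0 : norm2 q != 0 by rewrite norm2_eq0.
have Ee0 : E^T *m e = 0 by rewrite /e -scalemxAr Eq0 scaler0.
have FF : (row_mx e E)^T *m row_mx e E = 1%:M.
  rewrite tr_row_mx mul_col_row EE Ee0.
  rewrite -[e^T *m E]trmxK trmx_mul trmxK Ee0 trmx0.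
  rewrite (_ : e^T *m e = 1%:M) ?scalar_mx_block //.
  apply/matrixP => i j; rewrite !ord1 -dotE mxE eqxx dotZl dotZr -sqr_norm2.
  by rewrite expr2 mulKf ?mulVf.
have FC : S = row_mx e E *m block_mx (norm2 q)%:M 0 (E^T *m s) C.
  rewrite SE' mul_row_block mulmx0 add0r mul_mx_scalar /e scalerA mulfV //.
  by rewrite scale1r -sE.
by exists r.+1, (row_mx e E), (block_mx (norm2 q)%:M 0 (E^T *m s) C).
Qed.

End Vectors.

(** * Deterministic oracle inequality for the Lasso *)

Section Oracle.
Context {R : realType}.

(** First-order optimality without subgradients: compare [bh] with the points
    bh + t (b - bh), bound the l1 norm by convexity, divide by t and let t tend
    to 0, which removes the quadratic term. *)
Lemma lasso_variational n p (X : 'M[R]_(n, p)) y lambda bh b :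
  0 <= lambda -> is_lasso X y lambda bh ->
  n%:R^-1 * dot (X *m (b - bh)) (y - X *m bh) <=
    lambda * (norm1 b - norm1 bh).
Proof.
move=> l0 min_bh.
set D := dot _ _; set N := norm1 b - _; set Q := norm2 (X *m (b - bh)) ^+ 2.
have chord t : 0 < t -> t <= 1 ->
    n%:R^-1 * D <= t * ((2 * n%:R)^-1 * Q) + lambda * N.
  move=> t0 t1; have := min_bh (bh + t *: (b - bh)); rewrite /lasso_objective.
  rewrite mulmxDr opprD addrA -scalemxAr -[- (t *: _)]scaleNr.
  set r := y - X *m bh in D *.
  rewrite (sqr_norm2D r) dotZr norm2Z exprMn normrN real_normK ?num_real //.
  rewrite -/Q (dotC r) -/D => le_obj.
  have le_n1 : norm1 (bh + t *: (b - bh)) <= norm1 bh + t * N.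
    rewrite (_ : bh + _ = (1 - t) *: bh + t *: b); last first.
      by rewrite scalerBr scalerBl scale1r addrA addrAC.
    rewrite (le_trans (norm1D _ _))// !norm1Z (ger0_norm (ltW t0)).
    rewrite ger0_norm ?subr_ge0 //.
    by rewrite /N; lra.
  have : lambda * norm1 (bh + t *: (b - bh)) <= lambda * (norm1 bh + t * N).
    exact: ler_wpM2l.
  move: le_obj; rewrite invfM.
  move: (n%:R^-1) (norm2 r) (norm1 (bh + _)) (norm1 bh) => k a c d H1 H2.
  by rewrite -(ler_pM2l t0); move: H1 H2; lra.
apply/ler_addgt0Pr => e e0.
set c := (2 * n%:R)^-1 * Q in chord.
have c0 : 0 <= c by rewrite mulr_ge0 ?sqr_ge0 // invr_ge0 mulr_ge0.
have c1 : 0 < c + 1 by rewrite ltr_wpDl.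
(* the step at which the quadratic term of the chord inequality is at most e *)
pose t := Num.min 1 (e / (c + 1)).
have t0 : 0 < t by rewrite lt_min ltr01 divr_gt0.
have := chord t t0; rewrite ge_min lexx => /(_ isT) /le_trans; apply.
rewrite addrC lerD2l.
have : t * (c + 1) <= e.
  by rewrite -ler_pdivlMr // ge_min lexx orbT.
by rewrite mulrDr mulr1; move: t0; lra.
Qed.

Lemma rho_ge0 n p (X : 'M[R]_(n, p)) T : 0 <= rho X T.
Proof.
rewrite mulr_ge0 ?invr_ge0 ?sqrtr_ge0 //.
by elim/big_rec: _ => // j x _ x0; rewrite le_max x0 orbT.
Qed.

Lemma residual_le_rho n p (X : 'M[R]_(n, p)) T j : (0 < n)%N ->
  norm2 ((1%:M - orth_proj X T) *m col j X) <= Num.sqrt n%:R * rho X T.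
Proof.
move=> n0; rewrite mulrA divff ?mul1r; last first.
  by rewrite gt_eqF // sqrtr_gt0 ltr0n.
by rewrite (bigD1 j) //= le_max lexx.
Qed.

Lemma nu_ratio_ge0 n p (X : 'M[R]_(n, p)) (T : {set 'I_p}) u :
  0 <= Num.sqrt #|T|%:R * norm2 (subcols X T *m u) / (Num.sqrt n%:R * norm1 u).
Proof.
by rewrite divr_ge0 ?mulr_ge0 ?sqrtr_ge0 ?norm2_ge0 ?norm1_ge0.
Qed.

Lemma nu_ge0 n p (X : 'M[R]_(n, p)) T : 0 <= nu X T.
Proof.
rewrite /nu; set A := [set _ | _ in _].
have [->|A0] := eqVneq A set0; first by rewrite inf0.
by apply: lb_le_inf => [|_ [u _ <-]]; [exact/set0P | exact: nu_ratio_ge0].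
Qed.

(** The defining property of a compatibility constant, multiplied out so that it
    also holds at u = 0. *)
Lemma norm1_le_nu n p (X : 'M[R]_(n, p)) (T : {set 'I_p}) u : (0 < n)%N ->
  nu X T * Num.sqrt n%:R * norm1 u <=
    Num.sqrt #|T|%:R * norm2 (subcols X T *m u).
Proof.
move=> n0; have [->|u0] := eqVneq u 0.
  rewrite [norm1 _](eqP (etrans (norm1_eq0 _) (eqxx _))) mulr0.
  by rewrite mulr_ge0 ?sqrtr_ge0 ?norm2_ge0.
have nu1 : 0 < norm1 u.
  by rewrite lt_neqAle eq_sym norm1_eq0 u0 norm1_ge0.
rewrite -mulrA -ler_pdivlMr; last by rewrite mulr_gt0 // sqrtr_gt0 ltr0n.
apply: ge_inf; last by exists u.
by exists 0 => _ [v _ <-]; exact: nu_ratio_ge0.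
Qed.

(** Coefficients on T are completed by zeros, so that they can be added to
    vectors of regression coefficients. *)
Lemma subcols_extend n p (X : 'M[R]_(n, p)) (T : {set 'I_p}) (u : 'cV[R]_#|T|) :
  exists h : 'cV[R]_p, X *m h = subcols X T *m u /\ norm1 h <= norm1 u.
Proof.
exists (subcols 1%:M T *m u); split.
  by rewrite mulmxA /subcols mulmx_colsub mulmx1.
have le1 k : norm1 (u k 0 *: col k (subcols 1%:M T)) <= `|u k 0|.
  rewrite norm1Z -[leRHS]mulr1 ler_wpM2l // /norm1.
  rewrite (bigD1 (enum_val k)) //= big1 => [|i ik].
    by rewrite !mxE eqxx normr1 addr0.
  by rewrite !mxE (negbTE ik) normr0.
rewrite (_ : _ *m u = \sum_k u k 0 *: col k (subcols 1%:M T)); last first.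
  apply/colP => i; rewrite !mxE summxE; apply: eq_bigr => k _.
  by rewrite !mxE mulrC.
rewrite {2}/norm1; elim/big_ind2: _ => [|x a y b xa yb|k _]; last exact: le1.
  by rewrite /norm1 big1 // => i _; rewrite mxE normr0.
by rewrite (le_trans (norm1D _ _))// lerD.
Qed.

(** All cases of [nu_term] in which the bound is finite are covered by one
    number m: it is 0 when T is empty, and lambda sqrt |T| / nu otherwise. *)
Lemma nu_term_bound n p (X : 'M[R]_(n, p)) (T : {set 'I_p})
    (lambda : R) : (0 < n)%N -> 0 <= lambda -> nu_term X T lambda != +oo%E ->
  exists m, [/\ 0 <= m, nu_term X T lambda = (2 * m ^+ 2)%:E &
    forall u, Num.sqrt n%:R * lambda * norm1 u <= m * norm2 (subcols X T *m u)].
Proof.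
move=> n0 l0; rewrite /nu_term.
have [T0 _|T0] := eqVneq #|T| 0%N.
  exists 0; split=> //; first by rewrite expr0n mulr0.
  move=> u; rewrite mul0r /norm1 big1 ?mulr0 // => -[i i_lt].
  by exfalso; rewrite T0 in i_lt.
have [//|nu0 _] := eqVneq (nu X T) 0.
have nu_gt0 : 0 < nu X T by rewrite lt_neqAle eq_sym nu0 nu_ge0.
exists (lambda * Num.sqrt #|T|%:R / nu X T); split.
- by rewrite divr_ge0 ?mulr_ge0 ?sqrtr_ge0 // ltW.
- rewrite expr_div_n exprMn sqr_sqrtr //; congr EFin; field.
  by rewrite nu0.
move=> u; have := ler_wpM2l l0 (norm1_le_nu X u n0).
rewrite -(ler_pM2r nu_gt0 (_ * lambda * _)).
set M := norm2 _; set N := norm1 u => le_nu.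
have -> : Num.sqrt n%:R * lambda * N * nu X T =
    lambda * (nu X T * Num.sqrt n%:R * N) by ring.
have -> : lambda * Num.sqrt #|T|%:R / nu X T * M * nu X T =
    lambda * (Num.sqrt #|T|%:R * M) by field; rewrite nu0.
exact: le_nu.
Qed.

(** The arithmetic that combines the two comparisons.  Here a and q are the
    norms of the two parts of the error, z that of the noise inside the span,
    b and bh the l1 norms of the target and of the estimate.  If b + bh is at
    most 2 gamma / (gamma - 1) b, the bounds on a and q are used separately;
    otherwise the l1 contribution to the joint bound is nonpositive, and
    a^2 + q^2 <= a z already suffices. *)
Lemma two_regime_bound (a q z b bh m N s rho lambda gamma : R) :
  0 <= a -> 0 <= q -> 0 <= z -> 0 <= b -> 0 <= bh -> 0 <= m -> 0 <= s -> 0 < N ->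
  0 <= rho -> 0 < lambda -> 1 < gamma -> s ^+ 2 = N ->
  a <= z + s * m ->
  q <= s * rho * (b + bh) ->
  a ^+ 2 + q ^+ 2 <= a * z + N * lambda * ((b + bh) / gamma + b - bh) ->
  N^-1 * (a ^+ 2 + q ^+ 2) <=
    4 * rho ^+ 2 * gamma ^+ 2 / (gamma - 1) ^+ 2 * b ^+ 2
    + 2 * z ^+ 2 / N + 2 * m ^+ 2.
Proof.
move=> a0 q0 z0 b0 bh0 m0 s0 N0 r0 l0 g1 sN le_a le_q le_aq.
have g0 : 0 < gamma - 1 by rewrite subr_gt0.
have gg0 : 0 < gamma by rewrite (lt_trans _ g1).
have a2 : a ^+ 2 <= 2 * z ^+ 2 + 2 * (N * m ^+ 2).
  rewrite -sN -exprMn; move: (s * m) le_a => t le_a.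
  have : a ^+ 2 <= (z + t) ^+ 2 by rewrite lerXn2r ?nnegrE // (le_trans a0).
  by have := sqr_ge0 (z - t); lra.
set K := 2 * gamma / (gamma - 1).
rewrite (_ : 4 * _ * _ / _ * _ = (K * rho * b) ^+ 2); last first.
  by rewrite /K; field; rewrite subr_eq0 gt_eqF.
rewrite mulrC ler_pdivrMr // mulrDl (mulrDl (_ ^+ 2)) divfK ?gt_eqF //.
have [le_bh|lt_bh] := leP (b + bh) (K * b).
  have le_q' : q <= s * (K * rho * b).
    rewrite (le_trans le_q) // (_ : s * (K * _ * _) = s * rho * (K * b)).
      by rewrite ler_wpM2l ?mulr_ge0.
    by ring.
  have : q ^+ 2 <= N * (K * rho * b) ^+ 2.
    by rewrite -sN -exprMn lerXn2r ?nnegrE ?(le_trans q0).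
  by move: a2; lra.
have neg : (b + bh) / gamma + b - bh <= 0.
  rewrite -(pmulr_lle0 _ gg0) mulrBl mulrDl divfK ?gt_eqF //.
  have KE : K * b * (gamma - 1) = 2 * gamma * b.
    by rewrite /K; field; rewrite subr_eq0 gt_eqF.
  by move: lt_bh; rewrite -(ltr_pM2r g0) KE; lra.
have Nl : N * lambda * ((b + bh) / gamma + b - bh) <= 0.
  by rewrite mulr_ge0_le0 // mulr_ge0 // ltW.
have za : a ^+ 2 + q ^+ 2 <= 2 * z ^+ 2.
  have := sqr_ge0 (z - a / 2); have := sqr_ge0 a; have := sqr_ge0 q; lra.
have : 0 <= N * (K * rho * b) ^+ 2 by rewrite mulr_ge0 ?sqr_ge0 ?ltW.
have : 0 <= N * m ^+ 2 by rewrite mulr_ge0 ?sqr_ge0 ?ltW.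
by move: za; lra.
Qed.

(** The event on which this holds enters through the bound on the correlations
    between the noise and the residual columns; the noise inside the span is
    measured by its coordinates in the orthonormal family E. *)
Lemma oracle_inequality n p (X : 'M[R]_(n, p)) (T : {set 'I_p})
    (beta_star bh : 'cV[R]_p) (xi : 'cV[R]_n) (lambda gamma m : R)
    r (E : 'M[R]_(n, r)) (C : 'M[R]_(r, #|T|)) :
  (0 < n)%N -> 0 < lambda -> 1 < gamma -> 0 <= m ->
  E^T *m E = 1%:M -> subcols X T = E *m C ->
  (forall u, Num.sqrt n%:R * lambda * norm1 u <= m * norm2 (subcols X T *m u)) ->
  (forall j, `|dot ((1%:M - orth_proj X T) *m col j X) xi|
     <= n%:R * lambda / gamma) ->
  is_lasso X (X *m beta_star + xi) lambda bh ->
  pred_loss X bh beta_star <=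
    4 * rho X T ^+ 2 * gamma ^+ 2 / (gamma - 1) ^+ 2 * norm1 beta_star ^+ 2
    + 2 * norm2 (E^T *m xi) ^+ 2 / n%:R + 2 * m ^+ 2.
Proof.
move=> n0 l0 g1 m0 EE SE le_m noise lasso.
have N0 : 0 < n%:R :> R by rewrite ltr0n.
have s0 : 0 < Num.sqrt n%:R :> R by rewrite sqrtr_gt0.
have sN : Num.sqrt n%:R ^+ 2 = n%:R :> R by rewrite sqr_sqrtr // ltW.
have gg0 : 0 < gamma by rewrite (lt_trans _ g1).
set Q := 1%:M - orth_proj X T in noise *.
rewrite /pred_loss; set w := X *m (bh - beta_star).
pose a := orth_proj X T *m w; pose q := Q *m w.
have wE : w = a + q by rewrite /q mulmxBl mul1mx addrC subrK.
have [[u aE] Sq0] := orth_projP X T w; rewrite -/a in aE Sq0.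
have aq0 : dot a q = 0.
  by rewrite aE dot_mulmx /q mulmxBl mul1mx Sq0 dot0r.
have w2 : norm2 w ^+ 2 = norm2 a ^+ 2 + norm2 q ^+ 2.
  by rewrite wE sqr_norm2D aq0 mul0rn addr0.
(* a lies in the span of the orthonormal columns of E, hence is an isometric
   image of its coordinates there, and only those of xi matter *)
have a_xi : dot a xi <= norm2 a * norm2 (E^T *m xi).
  rewrite (_ : norm2 a = norm2 (C *m u)).
    by rewrite aE SE -mulmxA dot_mulmx cauchy_schwarz.
  apply/eqP; rewrite -(@eqrXn2 _ 2%N) ?norm2_ge0 // !sqr_norm2 aE SE.
  by rewrite -mulmxA dot_mulmx mulmxA EE mul1mx.
have q_xi : dot q xi <= norm1 (bh - beta_star) * (n%:R * lambda / gamma).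
  rewrite (le_trans (ler_norm _)) // /q /w mulmxA.
  by apply: dot_mulmx_norm1 => j; rewrite colEsub -mulmx_colsub -colEsub.
have [h [Xh le_h]] := subcols_extend X u.
rewrite w2.
apply: (@two_regime_bound _ _ (norm2 (E^T *m xi)) (norm1 beta_star) (norm1 bh) m
  n%:R (Num.sqrt n%:R) _ lambda) => //;
  rewrite ?norm2_ge0 ?norm1_ge0 ?rho_ge0 ?sqrtr_ge0 //.
(* the comparator that removes from the estimate its error inside the span *)
- have := lasso_variational (bh - h) (ltW l0) lasso.
  rewrite addrAC subrr add0r mulmxN Xh -aE.
  rewrite (_ : _ + xi - _ = xi - w); last first.
    by rewrite /w mulmxBr opprB [RHS]addrA (addrC xi).
  rewrite dotNl dotBr wE dotDr aq0 addr0 -sqr_norm2 opprB => le1.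
  have le2 : norm1 (bh - h) - norm1 bh <= norm1 u.
    by rewrite lerBlDl (le_trans (norm1B _ _)) // lerD2l.
  have le3 : norm2 a ^+ 2 - dot a xi <= n%:R * (lambda * norm1 u).
    by rewrite -ler_pdivrMl // (le_trans le1) // ler_pM2l.
  have [->|an0] := eqVneq (norm2 a) 0.
    by rewrite addr_ge0 ?mulr_ge0 ?norm2_ge0 // ltW.
  have a0 : 0 < norm2 a by rewrite lt_neqAle eq_sym an0 norm2_ge0.
  have le4 : n%:R * (lambda * norm1 u) <= Num.sqrt n%:R * (m * norm2 a).
    by rewrite -[X in X * _ <= _]sN expr2 -mulrA ler_pM2l // mulrA aE le_m.
  by rewrite -(ler_pM2l a0); move: le3 a_xi le4; lra.
- rewrite /q /w mulmxA mulrC.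
  apply: le_trans
    (@norm2_mulmx_norm1 _ _ _ _ _ (Num.sqrt n%:R * rho X T) _) _.
    by move=> j; rewrite colEsub -mulmx_colsub -colEsub; exact: residual_le_rho.
  rewrite ler_wpM2r ?(mulr_ge0 (sqrtr_ge0 _) (rho_ge0 _ _)) //.
  by rewrite (addrC (norm1 beta_star)) norm1B.
- have := lasso_variational beta_star (ltW l0) lasso.
  rewrite (_ : X *m (beta_star - bh) = - w); last by rewrite -mulmxN opprB.
  rewrite (_ : _ + xi - _ = xi - w); last first.
    by rewrite /w mulmxBr opprB [RHS]addrA (addrC xi).
  rewrite dotNl dotBr opprB -sqr_norm2 w2 [in dot w _]wE dotDl.
  rewrite ler_pdivrMl // => le1.
  have le2 : norm1 (bh - beta_star) * (n%:R * lambda / gamma) <=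
     n%:R * lambda * ((norm1 beta_star + norm1 bh) / gamma).
    rewrite mulrCA ler_pM2l ?mulr_gt0 //.
    by rewrite ler_pM2r ?invr_gt0 // (addrC (norm1 beta_star)) norm1B.
  by move: le1 le2 a_xi q_xi; lra.
Qed.

End Oracle.

(** * One-dimensional Gaussian calculus *)

Lemma measurable_gt_set (R : realType) d (T : measurableType d)
    (f : T -> measurableTypeR R) (c : R) :
  measurable_fun setT f -> measurable [set w | c < f w].
Proof.
move=> mf; have := mf measurableT _ (measurable_itv `]c, +oo[).
by rewrite setTI; congr measurable; apply/seteqP; split => w;
  rewrite /= in_itv /= andbT.
Qed.

Lemma measurable_ge_set (R : realType) d (T : measurableType d)
    (f : T -> measurableTypeR R) (c : R) :
  measurable_fun setT f -> measurable [set w | c <= f w].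
Proof.
move=> mf; have := mf measurableT _ (measurable_itv `[c, +oo[).
by rewrite setTI; congr measurable; apply/seteqP; split => w;
  rewrite /= in_itv /= andbT.
Qed.

Lemma measurable_expR_quadratic (R : realType) (k b : R) :
  measurable_fun setT
    (fun x : measurableTypeR R => (expR (k * x ^+ 2 + b * x))%:E).
Proof.
apply/measurable_EFinP; apply: measurableT_comp => //.
by apply: measurable_funD; apply: measurable_funM => //; exact: measurable_funX.
Qed.

Lemma measure_integral_indic (R : realType) d (T : measurableType d)
    (mu : {measure set T -> \bar R}) (A : set T) :
  measurable A -> mu A = (\int[mu]_x (\1_A x)%:E)%E.
Proof. by move=> mA; rewrite integral_indic // setIT. Qed.

(** The inequality 2 <= e, in the form in which it absorbs the exponential
    moment of each chi-square degree of freedom. *)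
Lemma sqrt2_le_expR (R : realType) : Num.sqrt 2 <= expR (1 / 2) :> R.
Proof.
rewrite -(@ler_pXn2r _ 2%N) ?nnegrE ?sqrtr_ge0 ?expR_ge0 // sqr_sqrtr //.
rewrite -expRM_natl (_ : 2%:R * (1 / 2) = 1)%R; last by field.
by rewrite (_ : 2 = 1 + 1)%R ?expR_ge1Dx // -natr1.
Qed.

Section GaussianDensity.
Context {R : realType}.

Lemma normal_pdf_expR (m s x : R) : s != 0 ->
  normal_pdf m s x =
    `|s|^-1 * normal_peak 1 * expR (- (x - m) ^+ 2 / (2 * s ^+ 2)).
Proof.
move=> s0; rewrite normal_pdfE // /normal_fun /normal_peak expr1n mul1r.
by rewrite -(mulr_natl (s ^+ 2)) -mulrnAr sqrtrM ?sqr_ge0 // sqrtr_sqr invfM.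
Qed.

Lemma normal_pdf_affine (m s x : R) : s != 0 ->
  `|s| * normal_pdf m s (m + s * x) = normal_pdf 0 1 x.
Proof.
move=> s0; rewrite !normal_pdf_expR ?oner_eq0 // normr1 invr1 mul1r.
rewrite !mulrA mulfV ?normr_eq0 // mul1r; congr (_ * expR _).
by field; rewrite s0.
Qed.

(** The rotation invariance of the plane Gaussian density, written as the
    disintegration of the law of (x, s x + t y) along its second coordinate:
    completing the square in x leaves the density of a centred normal variable
    of variance s^2 + t^2 in z, times a normal density in x. *)
Lemma normal_pdf_rotation (s t x z : R) : t != 0 ->
  normal_pdf (s * x) t z * normal_pdf 0 1 x =
  normal_pdf 0 (Num.sqrt (s ^+ 2 + t ^+ 2)) z *
  normal_pdf (s * z / (s ^+ 2 + t ^+ 2)) (t / Num.sqrt (s ^+ 2 + t ^+ 2)) x.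
Proof.
move=> t0.
have v0 : 0 < s ^+ 2 + t ^+ 2.
  by rewrite ltr_wpDl ?sqr_ge0 // lt_neqAle eq_sym sqrf_eq0 t0 sqr_ge0.
set r := Num.sqrt _.
have r0 : 0 < r by rewrite sqrtr_gt0.
have rE : r ^+ 2 = s ^+ 2 + t ^+ 2 by rewrite sqr_sqrtr // ltW.
have rn0 : r != 0 by rewrite gt_eqF.
rewrite !normal_pdf_expR ?oner_eq0 ?mulf_neq0 ?invr_eq0 //.
rewrite normr1 invr1 mul1r normrM normfV (gtr0_norm r0) (invfM `|t|) invrK.
move: (normal_peak 1) => k.
rewrite mulrACA -expRD [RHS]mulrACA -expRD; congr (_ * expR _).
  by field; rewrite rn0 normr_eq0 t0.
rewrite expr1n exprMn exprVn rE.
by field; rewrite t0 gt_eqF.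
Qed.

(** Completing the square.  The parameter is the standard deviation s of the
    tilted law rather than the coefficient of x^2, so that one formula covers
    linear exponents (s = 1) and x^2 / 4 (s = sqrt 2). *)
Lemma normal_pdf_tilt (s b x : R) : 0 < s ->
  expR ((1 - s ^- 2) / 2 * x ^+ 2 + b * x) * normal_pdf 0 1 x =
  s * expR (b ^+ 2 * s ^+ 2 / 2) * normal_pdf (b * s ^+ 2) s x.
Proof.
move=> s0; have sn0 : s != 0 by rewrite gt_eqF.
rewrite !normal_pdf_expR ?oner_eq0 // normr1 invr1 mul1r (gtr0_norm s0).
move: (normal_peak 1) => k.
rewrite mulrCA -expRD [RHS]mulrACA -expRD [X in _ = X * _]mulrA.
rewrite mulfV // mul1r; congr (_ * expR _).
by field; rewrite sn0.
Qed.

End GaussianDensity.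

Section AffineIntegral.
Context {R : realType}.
Local Notation mu := (@lebesgue_measure R).
Local Notation MR := (measurableTypeR R).
Local Open Scope ereal_scope.

Lemma measurable_affine (m s : R) :
  measurable_fun setT (fun x : MR => (m + s * x)%R : MR).
Proof. by apply: measurable_funD => //; exact: measurable_funM. Qed.

Lemma measurable_affine_preimage (m s : R) (B : set MR) :
  measurable B -> measurable [set x : MR | B (m + s * x)%R].
Proof.
by move=> mB; have := measurable_affine m s measurableT mB; rewrite setTI.
Qed.

Lemma lebesgue_affine (s m : R) (B : set MR) : s != 0%R -> measurable B ->
  mu B = `|s|%:E * mu [set x | B (m + s * x)%R].
Proof.
move=> s0 mB.
have k0 : (0 <= `|s|)%R by [].
pose f (x : MR) : MR := (m + s * x)%R.
have mf : measurable_fun setT f by exact: measurable_affine.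
rewrite (_ : _ * _ = mscale (NngNum k0) (pushforward mu f) B) //.
apply: lebesgue_measure_unique => // _ [[a b]] _ <-.
rewrite /= /mscale/= /pushforward.
rewrite lebesgue_measure_itv/= lte_fin.
have [s_gt0|s_lt0] := ltP 0%R s; last first.
  have {}s_lt0 : (s < 0)%R by rewrite lt_neqAle s0.
  rewrite (_ : f @^-1` _ = `[((b - m) / s)%R, ((a - m) / s)%R[%classic);
    last first.
    by apply/seteqP; split => x; rewrite /f/= !in_itv/= ler_ndivrMr//
      ltr_ndivlMr// ltrBlDl lerBrDl (mulrC x) andbC.
  rewrite lebesgue_measure_itv/= lte_fin ltr_nM2r ?invr_lt0// ltrD2r.
  case: ifP => _; last by rewrite mule0.
  rewrite -EFinB -EFinB -EFinM ltr0_norm//; congr EFin; field.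
  by rewrite lt_eqF.
rewrite (_ : f @^-1` _ = `]((a - m) / s)%R, ((b - m) / s)%R]%classic); last first.
  by apply/seteqP; split => x; rewrite /f/= !in_itv/= ler_pdivlMr//
    ltr_pdivrMr// ltrBlDl lerBrDl (mulrC x).
rewrite lebesgue_measure_itv/= lte_fin ltr_pM2r ?invr_gt0// ltrD2r.
case: ifP => _; last by rewrite mule0.
rewrite -EFinB -EFinB -EFinM gtr0_norm//; congr EFin; field.
by rewrite gt_eqF.
Qed.

Lemma integral_affine (s m : R) (f : MR -> \bar R) : s != 0%R ->
  measurable_fun [set: MR] f -> (forall x, 0 <= f x) ->
  \int[mu]_x f x = `|s|%:E * \int[mu]_x f (m + s * x)%R.
Proof.
move=> s0 mf f0.
have k0 : (0 <= `|s|)%R by [].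
pose g (x : MR) : MR := (m + s * x)%R.
have mg : measurable_fun setT g by exact: measurable_affine.
rewrite (eq_measure_integral (mscale (NngNum k0) (pushforward mu g))); last first.
  by move=> A mA _; exact: lebesgue_affine.
rewrite ge0_integral_mscale// ge0_integral_pushforward//.
Qed.

(** Radon-Nikodym derivatives are unique up to null sets, so the density may
    replace the abstract derivative in the change of variables formula. *)
Lemma integral_normal_prob (m s : R) (f : MR -> \bar R) :
  measurable_fun [set: MR] f -> (forall x, 0 <= f x) ->
  \int[normal_prob m s]_x f x = \int[mu]_x (f x * (normal_pdf m s x)%:E).
Proof.
move=> mf f0.
have dom := @normal_prob_dominates R m s.
rewrite -(Radon_Nikodym_SigmaFinite.change_of_variables dom)//.
have mpdf : measurable_fun [set: MR] (fun x => (normal_pdf m s x)%:E).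
  by apply/measurable_EFinP; exact: measurable_normal_pdf.
have iRN := Radon_Nikodym_SigmaFinite.f_integrable dom.
apply: ae_eq_integral => //.
- by apply: emeasurable_funM => //; exact: measurable_int iRN.
- exact: emeasurable_funM.
- apply: ae_eqe_mul2l; apply: integral_ae_eq => //.
  by move=> A _ mA; rewrite -Radon_Nikodym_SigmaFinite.f_integral.
Qed.

End AffineIntegral.

Section GaussianMeasure.
Context {R : realType}.
Local Notation mu := (@lebesgue_measure R).
Local Notation MR := (measurableTypeR R).
Local Open Scope ereal_scope.

Lemma measurable_EFin_normal_pdf (m s : R) :
  measurable_fun [set: MR] (fun x => (normal_pdf m s x)%:E).
Proof. by apply/measurable_EFinP; exact: measurable_normal_pdf. Qed.

Lemma integral_normal_affine (m s : R) (f : MR -> \bar R) : s != 0%R ->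
  measurable_fun [set: MR] f -> (forall x, 0 <= f x) ->
  \int[normal_prob 0 1]_x f (m + s * x)%R = \int[normal_prob m s]_x f x.
Proof.
move=> s0 mf f0.
have maff := measurable_affine m s.
have mfaff : measurable_fun [set: MR] (fun x : MR => f (m + s * x)%R).
  exact: measurableT_comp.
rewrite (@integral_normal_prob _ 0 1 _ mfaff (fun x => f0 _)).
rewrite (@integral_normal_prob _ m s _ mf f0).
have pdf0 (m' s' x : R) : 0 <= (normal_pdf m' s' x)%:E.
  by rewrite lee_fin normal_pdf_ge0.
rewrite [RHS](@integral_affine _ s m) //; last 2 first.
- by apply: emeasurable_funM => //; exact: measurable_EFin_normal_pdf.
- by move=> x; exact: mule_ge0.
rewrite -ge0_integralZl //; last 2 first.
- apply: emeasurable_funM => //; apply/measurable_EFinP.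
  by apply: measurableT_comp => //; exact: measurable_normal_pdf.
- by move=> x _; exact: mule_ge0.
by apply: eq_integral => x _; rewrite muleCA -EFinM normal_pdf_affine.
Qed.

(** Only t is assumed nonzero: the inner integral then has a density, and
    s = 0 is the case where the first variable is still an empty sum. *)
Lemma integral_normal_convolution (s t : R) (f : MR -> \bar R) : t != 0%R ->
  measurable_fun [set: MR] f -> (forall x, 0 <= f x) ->
  \int[normal_prob 0 1]_x \int[normal_prob 0 1]_y f (s * x + t * y)%R =
  \int[normal_prob 0 (Num.sqrt (s ^+ 2 + t ^+ 2))]_z f z.
Proof.
move=> t0 mf f0.
have pdf0 (m' s' x : R) : 0 <= (normal_pdf m' s' x)%:E.
  by rewrite lee_fin normal_pdf_ge0.
have mjoint : measurable_fun setT
    (fun w : MR * MR => (normal_pdf (s * w.1) t w.2)%:E).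
  apply/measurable_EFinP; under eq_fun do rewrite normal_pdf_expR //.
  apply: measurable_funM => //; apply: measurableT_comp => //.
  apply: measurable_funM => //; apply: measurableT_comp => //.
  apply: measurable_funX; apply: measurable_funB => //.
  exact: measurable_funM.
have mf2 : measurable_fun setT (fun w : MR * MR => f w.2).
  exact: measurableT_comp.
under eq_integral do rewrite integral_normal_affine // integral_normal_prob //.
rewrite [LHS]integral_normal_prob; last 2 first.
- have := @measurable_fun_fubini_tonelli_F _ _ _ _ _ mu
    (fun w : MR * MR => f w.2 * (normal_pdf (s * w.1) t w.2)%:E).
  rewrite /fubini_F /=; apply; first exact: emeasurable_funM.
  by move=> w; exact: mule_ge0.
- by move=> x; apply: integral_ge0 => y _; exact: mule_ge0.
transitivity (\int[mu]_x \int[mu]_z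
   (f z * (normal_pdf (s * x) t z)%:E * (normal_pdf 0 1 x)%:E)).
  apply: eq_integral => x _; rewrite ge0_integralZr //.
  - apply: emeasurable_funM => //; exact: measurable_EFin_normal_pdf.
  - by move=> z _; exact: mule_ge0.
rewrite (@fubini_tonelli _ _ _ _ _ mu mu (fun w : MR * MR =>
  f w.2 * (normal_pdf (s * w.1) t w.2)%:E * (normal_pdf 0 1 w.1)%:E));
  last 2 first.
- apply: emeasurable_funM; first exact: emeasurable_funM.
  by apply: (measurableT_comp (measurable_EFin_normal_pdf 0 1)).
- by move=> w; rewrite !mule_ge0.
rewrite integral_normal_prob //; apply: eq_integral => z _ /=.
under eq_integral => x _.
  rewrite -muleA -EFinM normal_pdf_rotation // EFinM muleA; over.
rewrite ge0_integralZl //; last 2 first.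
- exact: measurable_EFin_normal_pdf.
- exact: mule_ge0.
by rewrite integral_normal_pdf mule1.
Qed.

Lemma integral_normal_tilt (s b : R) : (0 < s)%R ->
  \int[normal_prob 0 1]_x (expR ((1 - s ^- 2) / 2 * x ^+ 2 + b * x))%:E =
  (s * expR (b ^+ 2 * s ^+ 2 / 2))%:E.
Proof.
move=> s0; rewrite integral_normal_prob; last 2 first.
- apply/measurable_EFinP; apply: measurableT_comp => //.
  apply: measurable_funD; apply: measurable_funM => //.
- by move=> x; rewrite lee_fin expR_ge0.
under eq_integral do rewrite -EFinM normal_pdf_tilt // EFinM.
rewrite ge0_integralZl //; last 3 first.
- exact: measurable_EFin_normal_pdf.
- by move=> x _; rewrite lee_fin normal_pdf_ge0.
- by rewrite lee_fin mulr_ge0 ?expR_ge0 // ltW.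
by rewrite integral_normal_pdf mule1.
Qed.

(** Translating by t multiplies the density at u by exp (- t u - t^2 / 2), and
    the first part of the exponent is nonpositive on B. *)
Lemma normal_prob_shift (t : R) (B : set MR) : measurable B ->
  (forall u, B u -> 0 <= t * u)%R ->
  normal_prob 0 1 [set x | B (x - t)%R] <=
    (expR (- t ^+ 2 / 2))%:E * normal_prob 0 1 B.
Proof.
move=> mB tB.
have mind (A : set MR) : measurable A ->
    measurable_fun [set: MR] (fun x => (\1_A x)%:E : \bar R).
  by move=> mA; apply/measurable_EFinP; exact: measurable_indic.
have prob_indic (A : set MR) : measurable A ->
    normal_prob 0 1 A = \int[mu]_x ((\1_A x)%:E * (normal_pdf 0 1 x)%:E).
  move=> mA; rewrite -integral_normal_prob//; last by exact: mind.
  exact: measure_integral_indic.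
have pdf0 (x : R) : 0 <= (normal_pdf 0 1 x)%:E :> \bar R.
  by rewrite lee_fin normal_pdf_ge0.
have mshift : measurable [set x : MR | B (x - t)%R].
  have msub : measurable_fun setT (fun x : MR => (x - t)%R : MR).
    exact: measurable_funB.
  by have := msub measurableT _ mB; rewrite setTI.
rewrite !prob_indic //.
rewrite [X in X <= _](@integral_affine _ 1 t) ?oner_eq0 //; last 2 first.
- by apply: emeasurable_funM; [exact: mind | exact: measurable_EFin_normal_pdf].
- by move=> x; rewrite mule_ge0 // lee_fin.
rewrite normr1 mul1e -ge0_integralZl //; last 2 first.
- by apply: emeasurable_funM; [exact: mind | exact: measurable_EFin_normal_pdf].
- by move=> x _; rewrite mule_ge0 // lee_fin.
apply: ge0_le_integral => //.
- by move=> x _; rewrite mule_ge0 // lee_fin.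
- apply: (measurableT_comp (f := fun y : MR => (\1_[set x | B (x - t)%R] y)%:E *
    (normal_pdf 0 1 y)%:E) _ (measurable_affine t 1)).
  by apply: emeasurable_funM; [exact: mind | exact: measurable_EFin_normal_pdf].
- apply: emeasurable_funM => //.
  by apply: emeasurable_funM; [exact: mind | exact: measurable_EFin_normal_pdf].
move=> u _; rewrite mul1r.
rewrite (_ : \1_[set x | B (x - t)%R] (t + u)%R = \1_B u)%R; last first.
  rewrite !indicE; congr ((nat_of_bool _)%:R).
  by apply/idP/idP; rewrite !inE /= addrC addKr.
rewrite !indicE; have [uB|_] := boolP (u \in B); last by rewrite !mul0e mule0.
rewrite !mul1e -EFinM lee_fin !normal_pdf_expR ?oner_eq0 //.
rewrite [X in (_ <= X)%R]mulrCA ler_wpM2l ?mulr_ge0 ?invr_ge0 ?normal_peak_ge0 //.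
rewrite -expRD ler_expR; have := tB u; rewrite inE in uB => /(_ uB).
by lra.
Qed.

(** Both tails are translates of half-lines, and the half-lines have total mass
    at most 1: this is where the factor 2 of the union of two one-sided bounds
    is saved. *)
Lemma normal_prob_tail (t : R) : (0 <= t)%R ->
  normal_prob 0 1 [set x | t < `|x|]%R <= (expR (- t ^+ 2 / 2))%:E.
Proof.
move=> t0.
pose A := `]0%R, +oo[%classic : set MR; pose B := `]-oo, 0%R[%classic : set MR.
have msub c (D : set MR) : measurable D -> measurable [set x : MR | D (x - c)%R].
  move=> mD; have mf : measurable_fun setT (fun x : MR => (x - c)%R : MR).
    exact: measurable_funB.
  by have := mf measurableT _ mD; rewrite setTI.
have mA : measurable A by exact: measurable_itv.
have mB : measurable B by exact: measurable_itv.
have -> : [set x | t < `|x|]%R =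
    [set x | A (x - t)%R] `|` [set x | B (x - - t)%R].
  apply/seteqP; split => x; rewrite /A /B /= !in_itv /= ?andbT subr_gt0 opprK.
    by rewrite lter_normr => /orP[|]; [left|right; lra].
  by rewrite lter_normr; case=> ?; apply/orP; [left|right; lra].
have le1 := @measureU2 _ _ _ (normal_prob 0 1) _ _
  (msub t _ mA) (msub (- t)%R _ mB).
apply: le_trans le1 _.
have AB1 : normal_prob 0 1 A + normal_prob 0 1 B <= (1 : \bar R).
  rewrite -measureU //; first exact/probability_le1/measurableU.
  apply/seteqP; split => x //; rewrite /A /B /= !in_itv /= andbT => -[x1 x2].
  by have := lt_trans x1 x2; rewrite ltxx.
rewrite -[leRHS]mule1; apply: (le_trans _ (lee_wpmul2l _ AB1)); last first.
  by rewrite lee_fin expR_ge0.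
rewrite ge0_muleDr ?measure_ge0 //; apply: leeD.
  apply: normal_prob_shift => // u.
  by rewrite /A /= in_itv /= andbT => u0; exact/mulr_ge0/ltW.
rewrite -[X in expR (- X / _)]sqrrN; apply: normal_prob_shift => // u.
by rewrite /B /= in_itv /= => u0; rewrite mulr_le0 ?oppr_le0 // ltW.
Qed.

Lemma normal_prob_affine (m s : R) (B : set MR) : s != 0%R -> measurable B ->
  normal_prob 0 1 [set x | B (m + s * x)%R] = normal_prob m s B.
Proof.
move=> s0 mB.
have mB' := measurable_affine_preimage m s mB.
rewrite [RHS]measure_integral_indic // -integral_normal_affine //; last first.
  by apply/measurable_EFinP; exact: measurable_indic.
by rewrite [LHS]measure_integral_indic.
Qed.

End GaussianMeasure.

(** * Linear and quadratic forms of isotropic Gaussian noise *)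

(** The total mass c is not normalized to 1 because the lemma is applied to the
    restriction of a probability to an event, which may be null. *)
Lemma joint_law (R : realType) d (T : measurableType d)
    (mu : {measure set T -> \bar R})
    (X Y : T -> measurableTypeR R)
    (m1 m2 : probability (measurableTypeR R) R) (c : R)
    (D : set (measurableTypeR R * measurableTypeR R)) :
  measurable_fun setT X -> measurable_fun setT Y -> 0 <= c ->
  (forall A B, measurable A -> measurable B ->
     mu (X @^-1` A `&` Y @^-1` B) = (c%:E * m1 A * m2 B)%E) ->
  measurable D ->
  mu [set w | D (X w, Y w)] = (c%:E * \int[m1]_x m2 [set y | D (x, y)])%E.
Proof.
move=> mX mY c0 XY mD.
pose XYf w := (X w, Y w).
have mXY : measurable_fun setT XYf by exact: measurable_fun_pair.
pose m1' : {finite_measure set (measurableTypeR R) -> \bar R} :=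
  mscale (NngNum c0) m1.
have prodE : (m1' \x m2)%E D = pushforward mu XYf D.
  have unique := @product_measure_unique _ _ _ _ _ m1' m2 (pushforward mu XYf).
  by apply: (unique mXY _ _ mD) => A B mA mB; exact: XY.
transitivity ((m1' \x m2)%E D); first by rewrite prodE.
have xsecE x : xsection D x = [set y | D (x, y)].
  by apply/seteqP; split => y; rewrite /xsection /= inE.
transitivity (\int[m1']_x m2 (xsection D x))%E => //.
rewrite /m1' ge0_integral_mscale//; first by under eq_integral do rewrite xsecE.
exact: measurable_fun_xsection.
Qed.

Section IsotropicNoise.
Context {R : realType} d (T : measurableType d) (P : probability T R) (n : nat).
Variables (s : R) (xi : 'I_n -> {RV P >-> R}).
Hypotheses (s_gt0 : (0 < s)%R) (gauss : isotropic_gaussian s xi).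
Local Notation MR := (measurableTypeR R).
Local Notation noise w := (\col_i xi i w).
Local Open Scope ereal_scope.

Lemma measurable_linear_form (a : 'I_n -> R) (J : seq 'I_n) :
  measurable_fun setT (fun w => \sum_(i <- J) a i * xi i w : MR)%R.
Proof.
apply: measurable_sum => i.
by apply: measurable_funM => //; exact: measurable_funP.
Qed.

(** Carrying an event on the remaining coordinates K through the induction
    replaces any statement about independence of groups of variables: to add
    the coordinate k, the induction hypothesis is used with k among the
    remaining ones, which makes the old partial sum and the coordinate k
    independent under P restricted to the event, and the two Gaussian laws are
    then convolved. *)
Lemma linear_form_law (a : 'I_n -> R) (J : seq 'I_n) (K : {set 'I_n})
    (A : 'I_n -> set R) (B : set MR) :
  uniq J -> (forall i, i \in J -> i \notin K) ->
  (forall i, measurable (A i)) -> measurable B ->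
  P ([set w | B (\sum_(i <- J) a i * xi i w)%R] `&`
     \bigcap_(i in [set i | i \in K]) xi i @^-1` A i) =
  normal_prob 0 1 [set x | B (s * Num.sqrt (\sum_(i <- J) a i ^+ 2) * x)%R] *
  P (\bigcap_(i in [set i | i \in K]) xi i @^-1` A i).
Proof.
have [indep law] := gauss.
elim: J K A B => [|k J IHJ] K A B.
  move=> _ _ mA mB; rewrite big_nil sqrtr0 mulr0; set H := \bigcap_(i in _) _.
  have [B0|B0] := pselect (B 0%R).
    rewrite (_ : [set _ | _] = setT) ?setTI; last first.
      by apply/seteqP; split => // w _; rewrite /= big_nil.
    rewrite (_ : [set _ | _] = setT) ?probability_setT ?mul1e //.
    by apply/seteqP; split => // x _; rewrite /= mul0r.
  rewrite (_ : [set _ | _] = set0) ?set0I ?measure0; last first.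
    by apply/seteqP; split => // w; rewrite /= big_nil.
  rewrite (_ : [set _ | _] = set0) ?measure0 ?mul0e //.
  by apply/seteqP; split => // x; rewrite /= mul0r.
move=> /= /andP[kJ uJ] kJK mA mB.
have kK : k \notin K by rewrite kJK ?mem_head.
have JK i : i \in J -> i \notin K by move=> iJ; rewrite kJK // in_cons iJ orbT.
have [ak0|ak0] := eqVneq (a k) 0%R.
  rewrite big_cons ak0 expr0n add0r -IHJ //; congr (P (_ `&` _)).
  by apply/seteqP; split => w; rewrite /= big_cons ak0 mul0r add0r.
set H := \bigcap_(i in _) _.
have mH : measurable H.
  apply: fin_bigcap_measurable => // i _.
  by rewrite -[X in measurable X]setTI; exact: measurable_funP.
set tau := (s * Num.sqrt (\sum_(i <- J) a i ^+ 2))%R.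
have tau0 : (0 <= tau)%R by rewrite mulr_ge0 ?sqrtr_ge0 // ltW.
pose X w : MR := (\sum_(i <- J) a i * xi i w)%R.
have mX : measurable_fun setT X by exact: measurable_linear_form.
have mtau : measurable_fun setT (fun x : MR => (tau * x)%R : MR).
  exact: measurable_funM.
have xi_law C : measurable C -> P (xi k @^-1` C) = normal_prob 0 s C.
  by move=> mC; rewrite -(law k).
pose tauf : {RV (normal_prob 0 1 : probability MR R) >-> MR} :=
  HB.pack (fun x : MR => (tau * x)%R : MR) (isMeasurableFun.Build _ _ _ _ _ mtau).
have PH : P H = (fine (P H))%:E by rewrite fineK ?fin_num_measure.
have joint C1 C2 : measurable C1 -> measurable C2 ->
    mrestr P mH (X @^-1` C1 `&` (xi k : T -> MR) @^-1` C2) =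
    (fine (P H))%:E * distribution (normal_prob 0 1) tauf C1 * normal_prob 0 s C2.
  move=> mC1 mC2; rewrite -PH.
  (* the event on the remaining coordinates, with k constrained to C2 *)
  pose A' i := if i == k then C2 else A i.
  have mA' i : measurable (A' i).
    by rewrite /A'; case: (i == k); [exact: mC2 | exact: mA].
  have HE : \bigcap_(i in [set i | i \in k |: K]) xi i @^-1` A' i =
      xi k @^-1` C2 `&` H.
    apply/seteqP; split => w.
      move=> Hw; split.
        by have := Hw k; rewrite /A' eqxx; apply; rewrite /= !inE eqxx.
      move=> i /= iK; have := Hw i; rewrite /A' /= !inE iK orbT.
      by rewrite (negbTE (_ : i != k)); [apply | apply: contraNneq kK => <-].
    move=> [wk wH] i /=; rewrite !inE /A'; case: eqP => [->|_] //= iK.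
    exact: wH.
  have indepE : P (xi k @^-1` C2 `&` H) = P (xi k @^-1` C2) * P H.
    rewrite -HE indep // big_setU1 //= {1}/A' eqxx indep //; congr (_ * _).
    apply: eq_bigr => i iK; rewrite /A'.
    by rewrite (negbTE (_ : i != k)) //; apply: contraNneq kK => <-.
  have := IHJ (k |: K) A' C1 uJ _ mA' mC1; rewrite HE indepE xi_law // => IH.
  rewrite /mrestr -setIA IH.
    by rewrite muleCA [RHS]muleC; congr (_ * _); exact: muleC.
  by move=> i iJ; rewrite !inE negb_or JK // andbT; apply: contraNneq kJ => <-.
have mD : measurable [set w : MR * MR | B (w.1 + a k * w.2)%R].
  have mf : measurable_fun setT (fun w : MR * MR => (w.1 + a k * w.2)%R : MR).
    by apply: measurable_funD => //; exact: measurable_funM.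
  by have := mf measurableT _ mB; rewrite setTI.
have as0 : (a k * s != 0)%R by rewrite mulf_neq0 // gt_eqF.
have mY : measurable_fun setT (xi k : T -> MR).
  exact: (@measurable_funPT _ _ _ _ (xi k)).
have step := joint_law mX mY (fine_ge0 (measure_ge0 P H)) joint mD.
transitivity (mrestr P mH [set w | B (X w + a k * xi k w)%R]).
  by congr (P (_ `&` _)); apply/seteqP; split => w; rewrite /= big_cons addrC.
rewrite step -PH muleC; congr (_ * _).
have mB_aff c e := measurable_affine_preimage c e mB.
rewrite ge0_integral_distribution //; last first.
  have := @measurable_fun_xsection _ _ MR MR R (normal_prob 0 s) _ mD.
  congr measurable_fun; apply/funext => x /=.
  by congr normal_prob; apply/seteqP; split => y; rewrite /xsection /= inE.
have innerE x : normal_prob 0 s [set y | B (tau * x + a k * y)%R] =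
    \int[normal_prob 0 1]_y (\1_B (tau * x + a k * s * y)%R)%:E.
  rewrite -normal_prob_affine ?gt_eqF //.
  rewrite (_ : [set _ | _] = [set y | B (tau * x + a k * s * y)%R]).
    by rewrite measure_integral_indic.
  by apply/seteqP; split => y; rewrite /= add0r mulrA.
under eq_integral do rewrite /= innerE.
rewrite (@integral_normal_convolution _ tau (a k * s)%R
  (fun z => (\1_B z)%:E)) //; last first.
  by apply/measurable_EFinP; exact: measurable_indic.
rewrite -[LHS]measure_integral_indic //.
set r := Num.sqrt (tau ^+ 2 + _).
have rE : r = (s * Num.sqrt (\sum_(i <- k :: J) a i ^+ 2))%R.
  rewrite /r /tau big_cons !exprMn sqr_sqrtr; last first.
    by apply: sumr_ge0 => i _; exact: sqr_ge0.
  rewrite (mulrC (a k ^+ 2)%R) -mulrDr addrC sqrtrM ?sqr_ge0 //.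
  by rewrite sqrtr_sqr gtr0_norm.
have r0 : r != 0%R.
  rewrite gt_eqF // sqrtr_gt0 ltr_wpDl ?sqr_ge0 //.
  by rewrite lt_neqAle eq_sym sqrf_eq0 as0 sqr_ge0.
rewrite -rE -[LHS]normal_prob_affine //; congr (normal_prob _ _ _).
by apply/seteqP; split => x; rewrite /= add0r.
Qed.

Lemma dot_noiseE (a : 'cV[R]_n) w :
  dot a (noise w) = (\sum_(i <- index_enum 'I_n) a i 0 * xi i w)%R.
Proof. by apply: eq_bigr => i _; rewrite mxE. Qed.

Lemma measurable_dot_noise (a : 'cV[R]_n) :
  measurable_fun setT (fun w => dot a (noise w) : MR).
Proof.
have := measurable_linear_form (fun i => a i 0%R) (index_enum 'I_n).
by congr measurable_fun; apply/funext => w; rewrite dot_noiseE.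
Qed.

Lemma dot_noise_law (a : 'cV[R]_n) (B : set MR) : measurable B ->
  P [set w | B (dot a (noise w))] =
  normal_prob 0 1 [set x | B (s * norm2 a * x)%R].
Proof.
move=> mB.
have := @linear_form_law (fun i => a i 0%R) (index_enum 'I_n) finset.set0
  (fun=> setT) B (index_enum_uniq _).
rewrite (_ : \bigcap_(i in _) _ = setT); last first.
  by apply/seteqP; split => // w _ i; rewrite /= inE.
rewrite setIT probability_setT mule1 => <- //.
  by congr (P _); apply/seteqP; split => w; rewrite /= dot_noiseE.
by move=> i _; rewrite inE.
Qed.

Lemma dot_noise_tail (a : 'cV[R]_n) (t : R) : (0 <= t)%R ->
  P [set w | s * norm2 a * t < `|dot a (noise w)|]%R <= (expR (- t ^+ 2 / 2))%:E.
Proof.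
move=> t0; pose c := (s * norm2 a * t)%R.
have c0 : (0 <= s * norm2 a)%R by rewrite mulr_ge0 ?norm2_ge0 // ltW.
have mabs : measurable_fun setT (fun u : MR => `|u|%R : MR).
  exact: normr_measurable.
rewrite (dot_noise_law a (measurable_gt_set c mabs)).
apply: le_trans (normal_prob_tail t0).
apply: le_measure; rewrite ?inE; try exact: measurable_gt_set.
  apply: (@measurable_gt_set _ _ _ (fun x : MR => `|(s * norm2 a * x)|%R : MR)).
  by apply: measurableT_comp => //; exact: measurable_funM.
move=> x /=; rewrite normrM (ger0_norm c0) /c => lt.
rewrite ltNge; apply: contraTN lt => le; rewrite -leNgt.
exact: ler_wpM2l.
Qed.

Lemma integral_expR_dot_noise (a : 'cV[R]_n) :
  \int[P]_w (expR (dot a (noise w)))%:E = (expR (s ^+ 2 / 2 * norm2 a ^+ 2))%:E.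
Proof.
have mf : measurable_fun setT (fun x : MR => (expR x)%:E).
  by apply/measurable_EFinP; exact: measurable_expR.
pose X : {RV P >-> MR} := HB.pack (fun w => dot a (noise w) : MR)
   (isMeasurableFun.Build _ _ _ _ _ (measurable_dot_noise a)).
have mc : measurable_fun setT (fun x : MR => (s * norm2 a * x)%R : MR).
  exact: measurable_funM.
transitivity (\int[pushforward P X]_x (expR x)%:E).
  by rewrite ge0_integral_pushforward.
rewrite (eq_measure_integral (pushforward (normal_prob 0 1)
    (fun x : MR => (s * norm2 a * x)%R : MR))); last first.
  by move=> B mB _; exact: dot_noise_law.
rewrite ge0_integral_pushforward //.
have := integral_normal_tilt (s * norm2 a)%R ltr01.
rewrite !expr1n invr1 subrr mul0r mul1r mulr1 exprMn mulrAC => <-.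
by apply: eq_integral => x _; rewrite mul0r add0r.
Qed.

Lemma measurable_norm2_noise r (E : 'M[R]_(n, r)) :
  measurable_fun setT (fun w => norm2 (E^T *m noise w)%R ^+ 2 : MR)%R.
Proof.
have : measurable_fun setT (fun w => \sum_k dot (col k E) (noise w) ^+ 2 : MR)%R.
  apply: measurable_sum => k; apply: measurable_funX.
  exact: measurable_dot_noise.
by congr measurable_fun; apply/funext => w; rewrite sqr_norm2_trmul.
Qed.

(** The variables <e, xi> for e in an orthonormal family are handled one at a
    time, without their joint law: exp (x^2 / (4 s^2)) is the mean over a
    standard normal g of exp (g x / (sqrt 2 s)), so that one square is traded, by
    exchanging integrals, for a shift of the linear form a along e.  The linear
    form is there to make the induction go through. *)
Lemma integral_expR_chi2 r (E : 'M[R]_(n, r)) (a : 'cV[R]_n) :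
  (E^T *m E = 1%:M)%R ->
  \int[P]_w (expR (dot a (noise w)
       + norm2 (E^T *m noise w)%R ^+ 2 / (4 * s ^+ 2)))%:E =
  (Num.sqrt 2 ^+ r *
     expR (s ^+ 2 / 2 * (norm2 a ^+ 2 + norm2 (E^T *m a)%R ^+ 2)))%:E.
Proof.
elim: r E a => [|r IHr] E a EE.
  have n0 (v : 'cV[R]_0) : (norm2 v = 0)%R.
    by apply/eqP; rewrite norm2_eq0; apply/eqP/colP => -[].
  rewrite n0 expr0n addr0 expr0 mul1r.
  rewrite -[RHS]integral_expR_dot_noise.
  by apply: eq_integral => w _; rewrite n0 expr0n mul0r addr0.
pose e : 'cV[R]_n := lsubmx (E : 'M[R]_(n, 1 + r)).
pose F : 'M[R]_(n, r) := rsubmx (E : 'M[R]_(n, 1 + r)).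
have [ee Fe FF] :
    [/\ (e^T *m e = 1%:M)%R, (F^T *m e = 0)%R & (F^T *m F = 1%:M)%R].
  have : ((row_mx e F)^T *m row_mx e F = 1%:M)%R by rewrite hsubmxK.
  by rewrite tr_row_mx mul_col_row scalar_mx_block => /eq_block_mx[].
have normE v :
    (norm2 (E^T *m v)%R ^+ 2 = dot e v ^+ 2 + norm2 (F^T *m v)%R ^+ 2)%R.
  have Ev : (E^T *m v = col_mx (e^T *m v) (F^T *m v))%R.
    by rewrite -mul_col_mx -tr_row_mx hsubmxK.
  have col2 : (norm2 (col_mx (e^T *m v) (F^T *m v))%R ^+ 2 =
      dot e v ^+ 2 + norm2 (F^T *m v)%R ^+ 2)%R.
    rewrite !sqr_norm2 [LHS]dotE tr_col_mx mul_row_col mxE -!dotE.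
    by rewrite {1}/dot big_ord1 -expr2 -dotE.
  by rewrite -col2 -Ev.
have ee1 : dot e e = 1%R by rewrite dotE ee mxE eqxx.
have s0 : s != 0%R by rewrite gt_eqF.
pose r2 := Num.sqrt 2 : R.
have r2_gt0 : (0 < r2)%R by rewrite sqrtr_gt0.
have r2E : (r2 ^+ 2 = 2)%R by rewrite sqr_sqrtr.
have r20 : r2 != 0%R by rewrite gt_eqF.
(* h averages over g, its second argument, to the integrand: g linearizes the
   square of the component along e *)
pose Q w := (norm2 (F^T *m noise w)%R ^+ 2 / (4 * s ^+ 2))%R.
pose h (z : T * MR) : \bar R :=
  (expR (dot a (noise z.1) + z.2 / (r2 * s) * dot e (noise z.1) + Q z.1))%:E.
transitivity (\int[P]_w \int[normal_prob 0 1]_g h (w, g)).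
  apply: eq_integral => w _.
  pose b := (dot e (noise w) / (r2 * s))%R.
  transitivity (\int[normal_prob 0 1]_g ((expR (dot a (noise w) + Q w))%:E *
      (expR ((1 - 1 ^- 2) / 2 * g ^+ 2 + b * g))%:E)).
    rewrite ge0_integralZl //; last exact: measurable_expR_quadratic.
    rewrite integral_normal_tilt // -EFinM mul1r -expRD normE /Q /b.
    congr (expR _)%:E; rewrite expr1n mulr1 expr_div_n exprMn r2E.
    by field.
  apply: eq_integral => g _; rewrite -EFinM -expRD /h /b; congr (expR _)%:E.
  by rewrite /=; field; rewrite s0 r20.
rewrite fubini_tonelli; last 2 first.
- apply/measurable_EFinP; apply: measurableT_comp => //.
  have mfst v : measurable_fun setT (fun z : T * MR => dot v (noise z.1) : MR).
    exact: (measurableT_comp (measurable_dot_noise v)).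
  apply: measurable_funD; last first.
    apply: measurable_funM => //.
    exact: (measurableT_comp (measurable_norm2_noise F)).
  apply: measurable_funD; first exact: mfst.
  by apply: measurable_funM; [exact: measurable_funM | exact: mfst].
- by move=> z; rewrite lee_fin expR_ge0.
transitivity (\int[normal_prob 0 1]_g (r2 ^+ r * expR (s ^+ 2 / 2 *
    (norm2 (a + (g / (r2 * s)) *: e)%R ^+ 2 + norm2 (F^T *m a)%R ^+ 2)))%:E).
  apply: eq_integral => g _.
  have := IHr F (a + (g / (r2 * s)) *: e)%R FF.
  rewrite mulmxDr -scalemxAr Fe scaler0 addr0 => <-.
  by apply: eq_integral => w _; rewrite /h /= dotDl dotZl.
set c := (s ^+ 2 / 2 * (norm2 a ^+ 2 + norm2 (F^T *m a)%R ^+ 2))%R.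
transitivity (\int[normal_prob 0 1]_g ((r2 ^+ r * expR c)%:E *
    (expR ((1 - r2 ^- 2) / 2 * g ^+ 2 + (s * dot a e / r2) * g))%:E)).
  apply: eq_integral => g _; rewrite -EFinM; congr EFin.
  rewrite -[RHS]mulrA -expRD; congr (_ * expR _)%R.
  rewrite sqr_norm2D norm2Z exprMn real_normK ?num_real //.
  rewrite (sqr_norm2 e) ee1 dotZr /c r2E.
  by rewrite (expr_div_n g) exprMn r2E; field; rewrite s0 r20.
rewrite ge0_integralZl //; last 2 first.
- exact: measurable_expR_quadratic.
- by rewrite lee_fin mulr_ge0 ?expR_ge0 ?exprn_ge0 // ltW.
rewrite integral_normal_tilt // -EFinM normE /c.
congr EFin; rewrite mulrACA -/r2 -expRD; congr (_ * expR _)%R.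
  by rewrite -exprSr.
by rewrite (dotC e a) r2E expr_div_n exprMn r2E; field.
Qed.

(** Markov's inequality for the exponential moment of order 1/4, which is
    sqrt 2 ^ r <= exp (m / 2). *)
Lemma chi2_tail r (E : 'M[R]_(n, r)) (m : nat) (L : R) :
  (E^T *m E = 1%:M)%R -> (r <= m)%N ->
  P [set w | s ^+ 2 * (2 * m%:R + 4 * L) < norm2 (E^T *m noise w)%R ^+ 2]%R <=
    (expR (- L))%:E.
Proof.
move=> EE rm.
have mQ : measurable_fun setT
    (fun w => norm2 (E^T *m noise w)%R ^+ 2 / (4 * s ^+ 2) : R)%R.
  by apply: measurable_funM => //; exact: (measurable_norm2_noise E).
pose Q : {RV P >-> R} :=
  HB.pack (fun w => norm2 (E^T *m noise w)%R ^+ 2 / (4 * s ^+ 2) : R)%R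
    (isMeasurableFun.Build _ _ _ _ _ mQ).
have s2 : (0 < 4 * s ^+ 2)%R by rewrite mulr_gt0 // exprn_gt0.
apply: (@le_trans _ _ (P [set w | m%:R / 2 + L <= Q w]%R)).
  apply: le_measure; rewrite ?inE.
  - apply: measurable_gt_set; exact: measurable_norm2_noise.
  - exact: (measurable_ge_set _ mQ).
  move=> w /= lt_w; rewrite ler_pdivlMr //; move: (ltW lt_w); lra.
apply: (le_trans (chernoff Q _ ltr01)).
rewrite /mmt_gen_fun unlock.
have -> : \int[P]_w ((expR \o 1 \o* Q) w)%:E = (Num.sqrt 2 ^+ r)%:E.
  have := integral_expR_chi2 0 EE.
  rewrite mulmx0 !sqr_norm2 !dot0r addr0 mulr0 expR0 mulr1 => <-.
  by apply: eq_integral => w _; rewrite /= dotC dot0r add0r mulr1.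
rewrite -EFinM lee_fin mul1r.
have le2 : (Num.sqrt 2 ^+ r <= expR (m%:R / 2) :> R)%R.
  apply: (@le_trans _ _ (Num.sqrt 2 ^+ m)%R).
    by rewrite ler_weXn2l // -[X in (X <= _)%R]sqrtr1 ler_wsqrtr // ler1n.
  have -> : (m%:R / 2 = m%:R * (1 / 2) :> R)%R by rewrite mul1r.
  by rewrite expRM_natl lerXn2r ?nnegrE ?sqrtr_ge0 ?expR_ge0 ?sqrt2_le_expR.
apply: (le_trans (ler_wpM2r (expR_ge0 _) le2)).
by rewrite -expRD ler_expR opprD addrA subrr add0r.
Qed.

End IsotropicNoise.

(** * The high-probability event *)

Lemma union_bound (R : realType) d (T : measurableType d)
    (mu : {measure set T -> \bar R}) (I : finType) (B : I -> set T)
    (b : I -> \bar R) :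
  (forall i, measurable (B i)) -> (forall i, mu (B i) <= b i)%E ->
  measurable (\big[setU/set0]_i B i) /\
  (mu (\big[setU/set0]_i B i) <= \sum_i b i)%E.
Proof.
move=> mB le_b; elim/big_ind2: _ => [|u U v V [mU Uu] [mV Vv]|i _].
- by rewrite measure0.
- split; first exact: measurableU.
  by rewrite (le_trans (measureU2 mu mU mV)) // leeD.
- by split.
Qed.

(** Each of the p linear forms fails with probability at most delta / p, the
    quadratic form with probability at most delta. *)
Lemma noise_event (R : realType) (n p : nat) d (Omega : measurableType d)
   (P : probability Omega R) (xi : 'I_n -> {RV P >-> R}) (s : R)
   (V : 'I_p -> 'cV[R]_n) r (E : 'M[R]_(n, r)) (m : nat) (delta : R) :
  (0 < p)%N -> 0 < s -> isotropic_gaussian s xi ->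
  E^T *m E = 1%:M -> (r <= m)%N ->
  0 < delta -> delta <= p%:R ->
  with_prob_at_least P (1 - 2 * delta)
    [set w | (forall j, `|dot (V j) (\col_i xi i w)| <=
                s * norm2 (V j) * Num.sqrt (2 * ln (p%:R / delta))) /\
             norm2 (E^T *m \col_i xi i w) ^+ 2 <=
                s ^+ 2 * (2 * m%:R + 4 * ln (1 / delta))].
Proof.
move=> p0 s0 gauss EE rm d0 dp.
have p0' : 0 < p%:R :> R by rewrite ltr0n.
set t := Num.sqrt _; set c := s ^+ 2 * _.
pose B0 := [set w | c < norm2 (E^T *m \col_i xi i w) ^+ 2].
pose B j := [set w | s * norm2 (V j) * t < `|dot (V j) (\col_i xi i w)|].
have t0 : 0 <= t by exact: sqrtr_ge0.
have PB0 : (P B0 <= delta%:E)%E.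
  rewrite (le_trans (chi2_tail s0 gauss _ EE rm)) // lee_fin.
  by rewrite div1r lnV ?posrE // opprK lnK ?posrE.
have PB j : (P (B j) <= (delta / p%:R)%:E)%E.
  rewrite (le_trans (dot_noise_tail s0 gauss _ t0)) // lee_fin /t.
  have l0 : 0 <= ln (p%:R / delta) by rewrite ln_ge0 // ler_pdivlMr // mul1r.
  rewrite sqr_sqrtr ?mulr_ge0 // mulNr mulrC mulKf //.
  by rewrite -lnV ?posrE ?divr_gt0 // invf_div lnK ?posrE ?divr_gt0.
have mB0 : measurable B0.
  by apply: measurable_gt_set; exact: measurable_norm2_noise.
have mB j : measurable (B j).
  apply: measurable_gt_set; apply: measurableT_comp => //.
  exact: measurable_dot_noise.
have [mU PU] := union_bound mB PB.
exists (~` (B0 `|` \big[setU/set0]_j B j)); split.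
- by apply: measurableC; exact: measurableU.
- move=> w; rewrite /= => /not_orP[/negP]; rewrite -leNgt => le0 nB.
  split => // j; rewrite leNgt; apply/negP => Bj; apply: nB.
  by rewrite (bigD1 j) //=; left.
rewrite probability_setC; last exact: measurableU.
rewrite EFinB; apply: leeB => //.
apply: le_trans (measureU2 P mB0 mU) _.
rewrite (_ : 2 * delta = delta + delta); last by ring.
rewrite EFinD; apply: leeD => //; apply: le_trans PU _.
rewrite sumEFin sumr_const card_ord lee_fin -[_ *+ p]mulr_natl.
by rewrite mulrCA mulfV ?mulr1 // gt_eqF.
Qed.

Theorem proposition5 (R : realType) (n p : nat) (hn : (0 < n)%N) (hp : (0 < p)%N)
    (X : 'M[R]_(n, p)) (hX : forall j : 'I_p, norm2 (col j X) ^+ 2 <= n%:R)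
    (beta_star : 'cV[R]_p) (sigma : R) (hsigma : 0 < sigma)
    (d : measure_display) (Omega : measurableType d) (P : probability Omega R)
    (xi : 'I_n -> {RV P >-> R}) (hxi : isotropic_gaussian sigma xi)
    (y : Omega -> 'cV[R]_n)
    (hy : forall w : Omega, y w = X *m beta_star + \col_i xi i w)
    (T : {set 'I_p}) (delta gamma : R) (hdelta : 0 < delta) (hgamma : 1 < gamma)
    (lambda : R) (hlambda0 : 0 < lambda)
    (hlambda : gamma * sigma * rho X T * Num.sqrt (2 * ln (p%:R / delta) / n%:R)
               <= lambda) :
  with_prob_at_least P (1 - 2 * delta)
    [set w : Omega | forall beta_hat : 'cV[R]_p,
       is_lasso X (y w) lambda beta_hat ->
       ((pred_loss X beta_hat beta_star)%:E <=
          (4 * rho X T ^+ 2 * gamma ^+ 2 / (gamma - 1) ^+ 2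
             * norm1 beta_star ^+ 2
           + 4 * sigma ^+ 2 * (#|T|%:R + 2 * ln (1 / delta)) / n%:R)%:E
          + nu_term X T lambda)%E].
Proof.
(* for delta >= 1/2 the probability to reach is nonpositive; below, p / delta
   is at least 1, so that its logarithm is nonnegative *)
have [le_delta|delta_lt] := leP (1 / 2) delta.
  exists classical_sets.set0; split => //.
  by rewrite measure0 lee_fin; move: le_delta; lra.
have delta_p : delta <= p%:R.
  by rewrite (le_trans (ltW delta_lt)) // (@le_trans _ _ 1) ?ler1n //; lra.
have [r [E [C [rT EE SE]]]] := gram_schmidt (subcols X T).
pose V j := (1%:M - orth_proj X T) *m col j X.
have [G [mG G_sub PG]] := noise_event V hp hsigma hxi EE rT hdelta delta_p.
exists G; split => // w /G_sub[noise_V noise_E] bh; rewrite hy => lasso.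
have [->|nu_fin] := eqVneq (nu_term X T lambda) +oo%E.
  by rewrite addey ?leey.
have [m [m0 -> le_m]] := nu_term_bound hn (ltW hlambda0) nu_fin.
rewrite -EFinD lee_fin.
have n_gt0 : 0 < n%:R :> R by rewrite ltr0n.
have gamma_gt0 : 0 < gamma by rewrite (lt_trans _ hgamma).
have noise j : `|dot (V j) (\col_i xi i w)| <= n%:R * lambda / gamma.
  rewrite (le_trans (noise_V j)) // ler_pdivlMr //.
  set t := Num.sqrt _.
  have le_rho : sigma * norm2 (V j) * t * gamma <=
      sigma * (Num.sqrt n%:R * rho X T) * t * gamma.
    do 2 (apply: ler_wpM2r; first by rewrite ?sqrtr_ge0 // ltW).
    by apply: ler_wpM2l; [exact: ltW | exact: residual_le_rho].
  apply: (le_trans le_rho).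
  have sqrt_n : Num.sqrt n%:R != 0 :> R by rewrite gt_eqF // sqrtr_gt0.
  have n_sqrt : Num.sqrt n%:R ^+ 2 = n%:R :> R by rewrite sqr_sqrtr // ltW.
  have := ler_wpM2l (ltW n_gt0) hlambda.
  rewrite [Num.sqrt (_ / n%:R)]sqrtrM; last first.
    by rewrite mulr_ge0 // ln_ge0 // ler_pdivlMr // mul1r.
  rewrite (sqrtrV (ltW n_gt0)) -/t => le_nl; apply: le_trans le_nl.
  rewrite -[X in _ <= X * _]n_sqrt le_eqVlt; apply/orP; left; apply/eqP.
  by field.
have := oracle_inequality hn hlambda0 hgamma m0 EE SE le_m noise lasso.
move=> /le_trans; apply.
rewrite lerD2r lerD2l ler_pM2r ?invr_gt0 //.
by move: noise_E; lra.
Qed.
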